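(* Let $\mathcal{C}$ be the class of all finite tournaments isomorphic to an induced subtournament of $\mathbf{S}(2)$. Every $\mathbf{X}\in\mathcal{C}$ has Ramsey degree in $\mathcal{C}$ equal to \[t_{\mathcal{C}}(\mathbf{X}) = \frac{2|\mathbf{X}|}{|\mathrm{Aut}(\mathbf{X})|}.\]
   Context: Let $\mathbb{T}$ be the unit circle in $\mathbb{C}$. The dense local order $\mathbf{S}(2)$ is the tournament whose vertices are the points of $\mathbb{T}$ with rational argument, with an arc from $x$ to $y$ iff $0<\arg(y/x)<\pi$. For tournaments $\mathbf{X},\mathbf{Z}$, $\binom{\mathbf{Z}}{\mathbf{X}}$ denotes the set of induced subtournaments of $\mathbf{Z}$ isomorphic to $\mathbf{X}$. For positive integers $k,l$, $\mathbf{Z}\to(\mathbf{Y})^{\mathbf{X}}_{k,l}$ means: for every map $\chi:\binom{\mathbf{Z}}{\mathbf{X}}\to\{0,\dots,k-1\}$ there is $\widetilde{\mathbf{Y}}\in\binom{\mathbf{Z}}{\mathbf{Y}}$ such that $\chi$ takes at most $l$ values on $\binom{\widetilde{\mathbf{Y}}}{\mathbf{X}}$. The Ramsey degree $t_{\mathcal{C}}(\mathbf{X})$ of $\mathbf{X}\in\mathcal{C}$ is the least $l\in\mathbb{N}\cup\{\infty\}$ such that for every $\mathbf{Y}\in\mathcal{C}$ and every $k\in\mathbb{N}$ there is $\mathbf{Z}\in\mathcal{C}$ with $\mathbf{Z}\to(\mathbf{Y})^{\mathbf{X}}_{k,l}$. $\mathrm{Aut}(\mathbf{X})$ is the automorphism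 group of $\mathbf{X}$. *)

(* Defs.v *)
From HB Require Import structures.
From mathcomp Require Import all_boot all_order all_algebra all_fingroup.
From mathcomp Require Import reals trigo Rstruct.
Set Implicit Arguments. Unset Strict Implicit. Unset Printing Implicit Defensive.
Import Order.TTheory GRing.Theory Num.Theory.

Record fin_tournament := FinTournament {
  vert : finType;
  arc : rel vert;
  arc_irrefl : irreflexive arc;
  arc_tourn : forall x y : vert, x != y -> (arc x y (+) arc y x) }.

(* A point of the unit circle with rational argument is represented by its
   (principal) argument q : rat with 0 <= q < 2 pi; distinct such q give
   distinct points. *)
Local Open Scope ring_scope.
Definition RR := Rdefinitions.R.

Definition S2vert := {q : rat | (0 <= (ratr q : RR)) && ((ratr q : RR) < 2 * pi)}.

(* principal argument (in [0, 2 pi)) of y / x, for x = e^{i a}, y = e^{i b},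
   0 <= a, b < 2 pi *)
Definition arg_quot (x y : S2vert) : RR :=
  let d := (ratr (val y) : RR) - ratr (val x) in
  if 0 <= d then d else d + 2 * pi.

Definition arcS2 (x y : S2vert) : bool := (0 < arg_quot x y) && (arg_quot x y < pi).

Definition inC (A : fin_tournament) : Prop :=
  exists f : vert A -> S2vert,
    injective f /\ forall x y : vert A, arc x y = arcS2 (f x) (f y).

Local Close Scope ring_scope.
Definition is_copy (X Z : fin_tournament) (S : {set vert Z}) : bool :=
  [exists e : {ffun vert X -> vert Z},
     [&& injectiveb e,
         [forall x, [forall y, arc x y == arc (e x) (e y)]] &
         S == e @: setT]].

Definition arrows (Z Y X : fin_tournament) (k l : nat) : Prop :=
  forall chi : {set vert Z} -> 'I_k,
    exists Yt : {set vert Z}, @is_copy Y Z Yt /\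
      #|[set chi S | S in [set S : {set vert Z} | @is_copy X Z S && (S \subset Yt)]]| <= l.

Definition ramsey_bound (X : fin_tournament) (l : nat) : Prop :=
  forall Y : fin_tournament, inC Y -> forall k : nat,
    exists Z : fin_tournament, inC Z /\ arrows Z Y X k l.

Definition ramsey_degree_is (X : fin_tournament) (t : nat) : Prop :=
  ramsey_bound X t /\ forall l : nat, ramsey_bound X l -> t <= l.

Definition autT (X : fin_tournament) : {set {perm vert X}} :=
  [set p : {perm vert X} | [forall x, [forall y, arc x y == arc (p x) (p y)]]].

(* Main.v *)
From mathcomp Require Import all_boot all_order all_algebra all_fingroup.
From mathcomp Require Import reals trigo Rstruct lra zify.
Require Import Defs.
Set Implicit Arguments. Unset Strict Implicit. Unset Printing Implicit Defensive.
Import Order.TTheory GRing.Theory Num.Theory.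

(* Reflecting the lower half of the circle through the centre turns a finite
   subtournament of S(2) into a linear order with a 0/1 label on each point, in
   which x -> y iff exactly one of "x < y" and "x and y have different labels"
   holds. Up to isomorphism such an expansion is a 0/1 word. Cutting the circle
   elsewhere changes the labels by a monotone pattern 0..01..1 or 1..10..0, and
   every expansion of X arises in this way, so X has exactly 2|X| expansions.
   Aut(X) acts freely on them, and the number t of words representing X
   satisfies t |Aut(X)| = 2|X|. Upper bound: the finite Ramsey theorem applied to
   01...01, colouring a set of blocks by the colours of all words read in these
   blocks, makes the colour of a copy of X depend only on its word. Lower bound:
   colour the copies of X by their words; all expansions of a long 01...01
   contain all t words. *)

Local Open Scope ring_scope.

(** * Points of the circle as labelled linear orders *)

Definition fold_half (R : realFieldType) (P a : R) : R := if P <= a then a - P else a.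

(** Inside one half-circle arcs follow the order of arguments, and replacing one endpoint by its
    antipode reverses the arc. Antipodal points have no arc between them; the last hypothesis
    excludes them. *)
Lemma half_turn_arc (R : realFieldType) (P a b : R) :
    0 <= a < 2 * P -> 0 <= b < 2 * P ->
    a = b \/ fold_half P a != fold_half P b ->
  (0 < if 0 <= b - a then b - a else b - a + 2 * P) &&
  ((if 0 <= b - a then b - a else b - a + 2 * P) < P) =
    (fold_half P a < fold_half P b) (+) ((P <= a) (+) (P <= b)).
Proof.
rewrite /fold_half => /andP[a0 a2] /andP[b0 b2] [<-|].
  by rewrite subrr lexx ltxx /= ltxx addbb.
by case: (lerP P a) => Pa; case: (lerP P b) => Pb; case: (lerP 0 (b - a)) => ab;
  move=> /eqP ne /=; rewrite ?addbT ?addbF;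
  match goal with |- _ && _ = ?e => case E : e end;
  move: E; (do ?[case: ltP => ?]) => //= _; exfalso; try lra; apply: ne; lra.
Qed.

(* The expansion of a tournament by a linear order, given by the injective key
   [r], and a labelling [c] by the two half-circles. *)
Definition expands (A : fin_tournament) (r : vert A -> nat) (c : vert A -> bool) :
    Prop :=
  injective r /\ forall x y : vert A, arc x y = (r x < r y)%N (+) (c x (+) c y).

Lemma arcS2E (p q : S2vert) :
    p = q \/ fold_half pi (ratr (val p) : RR) != fold_half pi (ratr (val q)) ->
  arcS2 p q = (fold_half pi (ratr (val p) : RR) < fold_half pi (ratr (val q)))
    (+) ((pi <= (ratr (val p) : RR)) (+) (pi <= (ratr (val q) : RR))).
Proof.
move=> pq; rewrite /arcS2 /arg_quot half_turn_arc ?(valP p) ?(valP q) //.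
by case: pq => [->|]; [left | right].
Qed.

Lemma inC_expands (A : fin_tournament) :
  inC A <-> exists r c, @expands A r c.
Proof.
split=> [[f [f_inj fE]]|[r [c [r_inj rc]]]].
- pose g x : RR := fold_half pi (ratr (val (f x))).
  pose c x := pi <= (ratr (val (f x)) : RR).
  have gneq x y : x != y -> g x != g y.
    (* Distinct points with the same folded argument are antipodal: both quotients have argument
       exactly [pi], so neither arc is present, contrary to [arc_tourn]. *)
    move=> xy; apply/eqP => gxy; have := arc_tourn xy; rewrite !fE.
    have fxy : ratr (val (f x)) != ratr (val (f y)) :> RR.
      by rewrite (inj_eq (fmorph_inj _)) (inj_eq val_inj) (inj_eq f_inj).
    move: fxy gxy (valP (f x)) (valP (f y)); rewrite /g /arcS2 /arg_quot /fold_half /=.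
    move: (ratr _ : RR) (ratr _ : RR) => a b.
    move=> /eqP ab; case: (lerP pi a) => pa; case: (lerP pi b) => pb gab
      /andP[a0 a2] /andP[b0 b2].
    + by exfalso; apply: ab; lra.
    + have -> : (0 <= b - a) = false by apply/negbTE; rewrite -ltNge; lra.
      have -> : (0 <= a - b) = true by lra.
      have -> : (b - a + 2 * pi < pi) = false by apply/negbTE; rewrite -leNgt; lra.
      have -> : (a - b < pi) = false by apply/negbTE; rewrite -leNgt; lra.
      by rewrite !andbF.
    + have -> : (0 <= a - b) = false by apply/negbTE; rewrite -ltNge; lra.
      have -> : (0 <= b - a) = true by lra.
      have -> : (a - b + 2 * pi < pi) = false by apply/negbTE; rewrite -leNgt; lra.
      have -> : (b - a < pi) = false by apply/negbTE; rewrite -leNgt; lra.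
      by rewrite !andbF.
    + by exfalso; apply: ab; lra.
  pose r x := #|[set y | g y < g x]|.
  have rlt x y : g x < g y -> (r x < r y)%N.
    move=> xy; apply: proper_card; apply/properP; split.
      by apply/subsetP => z; rewrite !inE => /lt_trans; apply.
    by exists x; rewrite !inE ?ltxx.
  have rE x y : (r x < r y)%N = (g x < g y).
    case: (ltgtP (g x) (g y)) => [/rlt //|/rlt|gxy].
      by move/ltnW; rewrite leqNgt => /negbTE.
    by rewrite /r gxy ltnn.
  exists r, c; split=> [x y rxy|x y].
    apply/eqP; apply: contraT => /gneq; rewrite neq_lt.
    by case/orP => /rlt; rewrite rxy ltnn.
  rewrite fE arcS2E ?rE //.
  by have [->|/gneq] := eqVneq x y; [left | right].
(* Disjoint slots of width [1 / K], ordered by [r], fit into [[0, 1]], well inside a half-circle; a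
   true label moves the slot by [pi]. That shift does not preserve rationality, so a rational is
   chosen afterwards in each moved slot, by density. *)
- pose K : RR := (\max_x r x)%N.+1%:R.
  have K0 : 0 < K by rewrite ltr0Sn.
  have rK x : ((r x)%:R + 1) / K <= 1 :> RR.
    by rewrite ler_pdivrMr // mul1r /K natr1 ler_nat ltnS leq_bigmax.
  have pi1 : 2 <= pi :> RR by exact: pi_ge2.
  (* The argument of [x] lies between [pi * c x + r x / K] and
     [pi * c x + (r x + 1) / K]. *)
  have ch x : exists q : rat,
      (r x)%:R / K < ratr q - (pi : RR) *+ c x < ((r x)%:R + 1) / K.
    have /rat_in_itvoo[q /andP[]] :
        (r x)%:R / K + (pi : RR) *+ c x < ((r x)%:R + 1) / K + (pi : RR) *+ c x.
      by rewrite ltrD2r ltr_pM2r ?invr_gt0 // ltrDl.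
    by rewrite /= !bnd_simp => h1 h2; exists q; rewrite ltrBrDr ltrBlDr h1.
  have [q qP] := fin_all_exists ch.
  have r0 x : 0 <= (r x)%:R / K by rewrite divr_ge0 ?ler0n ?ltW.
  have qS x : (0 <= (ratr (q x) : RR)) && ((ratr (q x) : RR) < 2 * pi).
    have /andP[] := qP x; have := rK x; have := r0 x.
    move: ((r x)%:R / K) (((r x)%:R + 1) / K) => u v.
    by case: (c x) => /=; rewrite ?mulr1n ?mulr0n => *; apply/andP; split; lra.
  have cE x : (pi <= (ratr (q x) : RR)) = c x.
    have /andP[] := qP x; have := rK x; have := r0 x.
    move: ((r x)%:R / K) (((r x)%:R + 1) / K) => u v.
    by case: (c x) => /=; rewrite ?mulr1n ?mulr0n => *;
      [apply/idP|apply/negbTE; rewrite -ltNge]; lra.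
  pose f x : S2vert := exist _ (q x) (qS x).
  have gE x : fold_half pi (ratr (val (f x)) : RR) = ratr (q x) - (pi : RR) *+ c x.
    by rewrite /fold_half /= cE; case: (c x); rewrite ?mulr1n ?mulr0n ?subr0.
  have gle x y : (r x < r y)%N ->
      fold_half pi (ratr (val (f x)) : RR) < fold_half pi (ratr (val (f y))).
    move=> rxy; rewrite !gE; have /andP[_ h1] := qP x; have /andP[h2 _] := qP y.
    apply: lt_trans h1 (le_lt_trans _ h2).
    by rewrite ler_pM2r ?invr_gt0 // natr1 ler_nat.
  have gne x y : x != y ->
      fold_half pi (ratr (val (f x)) : RR) != fold_half pi (ratr (val (f y))).
    by rewrite -(inj_eq r_inj) neq_ltn neq_lt => /orP[]/gle->; rewrite ?orbT.
  exists f; split=> [x y fxy|x y].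
    by apply/eqP; apply: contraT => /gne; rewrite fxy eqxx.
  rewrite rc arcS2E; last by have [->|/gne] := eqVneq x y; [left|right].
  rewrite /= !cE; congr (_ (+) _).
  case: (ltngtP (r x) (r y)) => [/gle -> //|/gle|/r_inj ->]; last by rewrite ltxx.
  by move/ltW; rewrite leNgt => /negbTE ->.
Qed.

Local Close Scope ring_scope.

(** * Finite Ramsey theorem, with finite sets as subsequences *)

Lemma ramsey (n : nat) (K : finType) (q : K -> nat) :
  exists N, forall (T : eqType) (A : seq T) (f : seq T -> K), N <= size A ->
    exists c B, [/\ subseq B A, size B = q c &
      forall s, subseq s B -> size s = n -> f s = c].
Proof.
elim: n K q => [|n IHn] K q.
  exists (\max_c q c) => T A f le_A; exists (f [::]), (take (q (f [::])) A).
  split; first exact: take_subseq.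
    by apply: size_takel; apply: leq_trans le_A; apply: (leq_bigmax (F := q)).
  by move=> s _ /size0nil ->.
(* The target sizes are allowed to depend on the colour so that one may induct
   on their sum. *)
have [p] := ubnP (\sum_c q c); elim: p q => // p IHp q; rewrite ltnS => le_p.
have [/existsP[c /eqP qc0]|/existsPn q_gt0] := boolP [exists c, q c == 0].
  exists 0 => T A f _; exists c, [::]; split; rewrite ?sub0seq ?qc0 // => s.
  by rewrite subseq0 => /eqP ->.
pose q' c0 c := q c - (c == c0).
have ch c0 : exists N, forall (T : eqType) (A : seq T) (f : seq T -> K), N <= size A ->
    exists c B, [/\ subseq B A, size B = q' c0 c &
      forall s, subseq s B -> size s = n.+1 -> f s = c].
  apply: IHp; apply: leq_trans le_p.
  rewrite (bigD1 c0) //= [X in _ < X](bigD1 c0) //= /q' eqxx subn1 -addSn.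
  rewrite prednK ?lt0n ?q_gt0 // leq_add2l.
  by apply: leq_sum => c _; exact: leq_subr.
have [N NP] := fin_all_exists ch.
(* Fix the first element [x] and colour [s] by [f (x :: s)]; on a long [B] this is a constant [c],
   and the maximum serves whichever [c] occurs. Inside [B], either another colour reaches its full
   target, or [c] reaches its target minus one and [x] supplies the missing element. *)
have [N1 N1P] := IHn K (fun=> \max_c N c).
exists N1.+1 => T [//|x A] f /=; rewrite ltnS => /(N1P T A (fun s => f (x :: s))).
move=> [c [B [BA sB fB]]].
have [|d [D [DB sD fD]]] := NP c T B f; first by rewrite sB leq_bigmax.
have [dc|dc] := eqVneq d c; last first.
  exists d, D; split=> //; last by rewrite sD /q' (negbTE dc) subn0.
  exact: subseq_trans DB (subseq_trans BA (subseq_cons A x)).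
rewrite dc in sD fD; exists c, (x :: D); split.
- by rewrite /= eqxx (subseq_trans DB BA).
- by rewrite /= sD /q' eqxx subn1 prednK // lt0n; exact: q_gt0.
- move=> [//|y s] /=; case: eqP => [-> sD' [sn]|_ ysD sn]; last exact: fD.
  by apply: fB => //; exact: subseq_trans sD' DB.
Qed.

(** * Increasing enumerations *)

Definition increasing (V : finType) (r : V -> nat) n (h : {ffun 'I_n -> V}) :=
  [forall i, forall j, (r (h i) < r (h j)) == (i < j)].

Lemma increasingP (V : finType) (r : V -> nat) n (h : {ffun 'I_n -> V}) :
  reflect (forall i j, (r (h i) < r (h j)) = (i < j)) (increasing r h).
Proof.
apply: (iffP forallP) => [H i j|H i]; first by have /forallP/(_ j)/eqP := H i.
by apply/forallP => j; rewrite H.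
Qed.

Lemma enum_increasing (V : finType) (r : V -> nat) n (S : {set V}) :
  injective r -> #|S| = n ->
  exists2 h : {ffun 'I_n -> V}, increasing r h & S = h @: setT.
Proof.
move=> r_inj Sn; pose s := sort (relpre r leq) (enum S).
have sn : size s == n by rewrite size_sort -cardE Sn.
have s_sorted : sorted (relpre r ltn) s.
  rewrite -sorted_map ltn_sorted_uniq_leq (map_inj_uniq r_inj) sort_uniq enum_uniq.
  by rewrite sorted_map sort_sorted // => x y; exact: leq_total.
pose h := [ffun i => tnth (Tuple sn) i].
have h_lt (i j : 'I_n) : i < j -> r (h i) < r (h j).
  move=> ij; rewrite !ffunE !(tnth_nth (h i)) /=.
  apply: (sorted_ltn_nth (leT := relpre r ltn)) => //; last 2 first.
  - by rewrite inE (eqP sn).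
  - by rewrite inE (eqP sn).
  - by move=> x y z; exact: ltn_trans.
exists h.
  apply/increasingP => i j; case: (ltngtP i j) => [/h_lt //|/h_lt|/ord_inj ->].
    by move/ltnW; rewrite leqNgt => /negbTE.
  by rewrite ltnn.
apply/setP => x; rewrite -[in LHS]mem_enum -(mem_sort (relpre r leq)).
apply/idP/imsetP => [|[i _ ->]]; last by rewrite ffunE; exact: (mem_tnth i (Tuple sn)).
by move=> /(tnthP (Tuple sn))[i ->]; exists i; rewrite ?ffunE.
Qed.

(** The index of a point is recovered from the image set alone, which makes the enumeration
    unique. *)
Lemma increasing_rank (V : finType) (r : V -> nat) n (h : {ffun 'I_n -> V}) i :
  increasing r h -> #|[set x in h @: setT | r x < r (h i)]| = i.
Proof.
move=> /increasingP hP.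
have -> : [set x in h @: setT | r x < r (h i)] = h @: [set j : 'I_n | j < i].
  apply/setP => x; rewrite inE; apply/andP/imsetP => [[/imsetP[j _ ->]]|[j]].
    by rewrite hP => ji; exists j; rewrite ?inE.
  by rewrite inE => ji ->; rewrite hP imset_f.
rewrite card_imset; last first.
  move=> j k jk; apply/eqP; rewrite -[_ == _]negbK -val_eqE neq_ltn -!hP jk.
  by rewrite ltnn.
by rewrite -sum1dep_card (big_ord_narrow (ltnW (ltn_ord i))) sum1_card card_ord.
Qed.

Lemma increasing_uniq (V : finType) (r : V -> nat) n (h h' : {ffun 'I_n -> V}) :
  increasing r h -> increasing r h' -> h @: setT = h' @: setT -> h = h'.
Proof.
move=> hP h'P hh'; apply/ffunP => i.
have /imsetP[j _ hi] : h i \in h' @: setT by rewrite -hh' imset_f.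
rewrite hi; congr (h' _); apply: ord_inj; apply: esym.
by rewrite -[LHS](increasing_rank i hP) hh' hi increasing_rank.
Qed.

(** * Comparing two expansions of one tournament *)

(** The index order and [r] are the orders of two expansions, and [d] marks the points whose labels
    differ; the hypothesis says that both give the same arcs. Keeping [m] below [n] makes the pair
    [(m, b)] unique, so that there are [2 * n] patterns. *)
Lemma switch_threshold n (d : 'I_n -> bool) (r : 'I_n -> nat) : 0 < n ->
  (forall i j, (r i < r j) = (i < j) (+) (d i (+) d j)) ->
  exists (m : 'I_n) b, forall i, d i = (i < m) (+) b.
Proof.
case: n d r => // n d r _ dr.
(* A pattern [d i = d k <> d j] with [i < j < k] would create a cycle for [r]. *)
have aba (i j k : 'I_n.+1) : i < j -> j < k -> d i = d k -> d j = d i.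
  move=> ij jk ik; have := dr j i; have := dr k j; have := dr i k.
  rewrite ik (ltn_trans ij jk) [k < j]ltnNge [j < i]ltnNge (ltnW ij) (ltnW jk) /=.
  by case: (d k) (d j) => [] [] //=; lia.
pose P m := [forall i : 'I_n.+1, (m <= i) ==> (d i == d ord_max)].
have exP : exists m, P m.
  exists n; apply/forallP => i; apply/implyP => ni.
  by apply/eqP; congr d; apply: ord_inj; rewrite /=; have := ltn_ord i; lia.
have [m /forallP Pm m_min] := ex_minnP exP.
have mn : m < n.+1.
  rewrite ltnS; apply: m_min; apply/forallP => i; apply/implyP => ni.
  by apply/eqP; congr d; apply: ord_inj; rewrite /=; have := ltn_ord i; lia.
exists (Ordinal mn), (d ord_max) => i /=.
have [im|mi] := ltnP i m; last by have /implyP/(_ mi)/eqP := Pm i.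
(* By minimality of [m], some [j >= i] disagrees with the last index. If [d i] agreed with it, then
   [i < j < ord_max] would be a pattern forbidden by [aba]. *)
have : ~~ P i by apply: contraL im => /m_min; rewrite -leqNgt.
case/forallPn => j; rewrite negb_imply => /andP[ij djn].
suff : d i != d ord_max by case: (d i) (d ord_max) => [] [].
apply: contraNneq djn => di; apply: contraLR (ij) => djn.
have jn : j < n.
  rewrite ltn_neqAle -ltnS ltn_ord andbT; apply: contraNneq djn => jn.
  by rewrite (_ : j = ord_max) //; apply: ord_inj.
rewrite -ltnNge ltn_neqAle [j <= i]leqNgt.
have [ij'|//|ji] := ltngtP i j; first by rewrite (aba i j ord_max) ?di ?eqxx in djn.
by rewrite -di (ord_inj ji) eqxx in djn.
Qed.

(** * Words and the tournaments they encode *)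

Definition embeds n (A : fin_tournament) (w : {ffun 'I_n -> bool})
    (e : {ffun 'I_n -> vert A}) :=
  [forall i, forall j, arc (e i) (e j) == (i < j) (+) (w i (+) w j)].

Lemma embedsP n (A : fin_tournament) (w : {ffun 'I_n -> bool})
    (e : {ffun 'I_n -> vert A}) :
  reflect (forall i j, arc (e i) (e j) = (i < j) (+) (w i (+) w j)) (embeds w e).
Proof.
apply: (iffP forallP) => [H i j|H i]; first by have /forallP/(_ j)/eqP := H i.
by apply/forallP => j; rewrite H.
Qed.

Lemma embeds_inj n (A : fin_tournament) (w : {ffun 'I_n -> bool})
    (e : {ffun 'I_n -> vert A}) :
  embeds w e -> injective e.
Proof.
move=> /embedsP eP i j eij; have := eP j i; have := eP i j.
rewrite eij arc_irrefl (addbC (w j)).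
by case: (ltngtP i j) => [||/ord_inj //]; case: (w i (+) w j).
Qed.

Lemma embeds_bij (A : fin_tournament) (w : {ffun 'I_#|vert A| -> bool})
    (e : {ffun 'I_#|vert A| -> vert A}) :
  embeds w e -> bijective e.
Proof. by move=> /embeds_inj e_inj; apply: inj_card_bij; rewrite ?card_ord. Qed.

Lemma embeds_onto (A : fin_tournament) (w : {ffun 'I_#|vert A| -> bool})
    (e : {ffun 'I_#|vert A| -> vert A}) :
  embeds w e -> e @: setT = setT.
Proof.
move=> /embeds_bij[g eK gK]; apply/setP => x; rewrite inE -(gK x).
exact: imset_f.
Qed.

Lemma expands_word (A : fin_tournament) r c n (S : {set vert A}) :
  expands r c -> #|S| = n ->
  exists2 h : {ffun 'I_n -> vert A}, increasing r h /\ S = h @: setT &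
    embeds [ffun i => c (h i)] h.
Proof.
move=> [r_inj rc] /(enum_increasing r_inj)[h hP Sh]; exists h => //.
by apply/embedsP => i j; rewrite !ffunE rc (increasingP _ _ hP).
Qed.

Fact switch_irrefl (V : finType) (r : V -> nat) (c : V -> bool) :
  irreflexive (fun x y => (r x < r y) (+) (c x (+) c y)).
Proof. by move=> x; rewrite ltnn addbb. Qed.

Fact switch_tourn (V : finType) (r : V -> nat) (c : V -> bool)
    (r_inj : injective r) (x y : V) :
  x != y -> ((r x < r y) (+) (c x (+) c y)) (+) ((r y < r x) (+) (c y (+) c x)).
Proof.
rewrite -(inj_eq r_inj) (addbC (c y)).
by case: ltngtP => //; case: (c x (+) c y).
Qed.

(** Seidel switching: a transitive tournament in which all arcs between the two label classes are
    reversed. *)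
Definition switch (V : finType) (r : V -> nat) (c : V -> bool)
    (r_inj : injective r) : fin_tournament :=
  FinTournament (switch_irrefl r c) (switch_tourn c r_inj).

Lemma switch_expands (V : finType) (r : V -> nat) (c : V -> bool)
    (r_inj : injective r) :
  @expands (switch c r_inj) r c.
Proof. by []. Qed.

Lemma copy_of_word (X Z : fin_tournament) (w : {ffun 'I_#|vert X| -> bool})
    (e : {ffun 'I_#|vert X| -> vert X}) (g : {ffun 'I_#|vert X| -> vert Z}) :
  embeds w e -> embeds w g -> is_copy X (g @: setT).
Proof.
move=> eP gP; have [f eK fK] := embeds_bij eP.
apply/existsP; exists [ffun x => g (f x)]; apply/and3P; split.
- apply/injectiveP => x y; rewrite !ffunE => /(embeds_inj gP).
  exact: (can_inj fK).
- apply/forallP => x; apply/forallP => y; rewrite !ffunE (embedsP _ _ gP).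
  by rewrite -(embedsP _ _ eP) !fK.
- apply/eqP/setP => z; apply/imsetP/imsetP => [[i _ ->]|[x _ ->]].
    by exists (e i); rewrite ?ffunE ?eK.
  by exists (f x); rewrite ?ffunE.
Qed.

Lemma card_copy (X Z : fin_tournament) (S : {set vert Z}) :
  is_copy X S -> #|S| = #|vert X|.
Proof.
case/existsP => e /and3P[/injectiveP e_inj _ /eqP ->].
by rewrite card_imset ?cardsT.
Qed.

(* Isomorphism types of expansions of [X]; their number is the Ramsey degree. *)
Definition words (X : fin_tournament) : {set {ffun 'I_#|vert X| -> bool}} :=
  [set w | [exists e : {ffun 'I_#|vert X| -> vert X}, embeds w e]].

Lemma copy_words (X Z : fin_tournament) (w : {ffun 'I_#|vert X| -> bool})
    (h : {ffun 'I_#|vert X| -> vert Z}) :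
  embeds w h -> is_copy X (h @: setT) -> w \in words X.
Proof.
move=> /embedsP hP /existsP[e /and3P[_ /forallP eP /eqP he]].
have ch i : exists x, h i = e x.
  have /imsetP[x _ ->] : h i \in e @: setT by rewrite -he imset_f.
  by exists x.
have [f fP] := fin_all_exists ch.
rewrite inE; apply/existsP; exists [ffun i => f i]; apply/embedsP => i j.
by rewrite !ffunE (eqP (forallP (eP _) _)) -!fP hP.
Qed.

Lemma inC_words (A : fin_tournament) : inC A <-> exists w, w \in words A.
Proof.
split=> [/inC_expands[r [c rc]]|[w]].
  have [h _ hP] := expands_word rc (cardsT _).
  exists [ffun i => c (h i)]; rewrite inE; apply/existsP.
  by exists h.
rewrite inE => /existsP[e eP]; apply/inC_expands.
have [g eK gK] := embeds_bij eP.
exists (val \o g), (w \o g); split; first exact: inj_comp val_inj (can_inj gK).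
by move=> x y; rewrite /= -(embedsP _ _ eP) !gK.
Qed.

(** Two embeddings of the same word differ by a unique automorphism, so [autT X] acts simply
    transitively on them. *)
Lemma card_embeds (X : fin_tournament) (w : {ffun 'I_#|vert X| -> bool}) :
  w \in words X ->
  #|[set e : {ffun 'I_#|vert X| -> vert X} | embeds w e]| = #|autT X|.
Proof.
rewrite inE => /existsP[e0 e0P]; have [g eK gK] := embeds_bij e0P.
pose F (p : {perm vert X}) := [ffun i => p (e0 i)].
rewrite -(card_imset (f := F)); last first.
  move=> p q /ffunP pq; apply/permP => x.
  by have := pq (g x); rewrite !ffunE gK.
apply: eq_card => e; rewrite inE; apply/idP/imsetP => [eP|[p]].
  have [f _ fK] := embeds_bij eP.
  have e_inj := embeds_inj eP.
  have eg_inj : injective (e \o g) by apply: inj_comp e_inj (can_inj gK).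
  exists (perm eg_inj); last by apply/ffunP => i; rewrite !ffunE permE /= eK.
  rewrite inE; apply/forallP => x; apply/forallP => y; rewrite !permE /=.
  by rewrite (embedsP _ _ eP) -(embedsP _ _ e0P) !gK.
rewrite inE => /forallP pP ->; apply/embedsP => i j.
by rewrite !ffunE -(eqP (forallP (pP _) _)) (embedsP _ _ e0P).
Qed.

(** * Counting expansions, each given as its word and its enumeration *)

Definition presentations (X : fin_tournament) :
    {set {ffun 'I_#|vert X| -> bool} * {ffun 'I_#|vert X| -> vert X}} :=
  [set we | embeds we.1 we.2].

Lemma card_presentations (X : fin_tournament) :
  #|presentations X| = #|words X| * #|autT X|.
Proof.
rewrite -sum1dep_card.
rewrite -(pair_big_dep xpredT (fun w e => embeds w e) (fun _ _ => 1)) /=.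
rewrite -sum_nat_const [RHS]big_mkcond /=; apply: eq_bigr => w _.
rewrite sum1dep_card; case: ifP => [|wX]; first exact: card_embeds.
apply/eqP; rewrite cards_eq0; apply/eqP/setP => e; rewrite !inE.
by apply: contraFF wX => eP; rewrite inE; apply/existsP; exists e.
Qed.

Definition labelling (X : fin_tournament)
    (we : {ffun 'I_#|vert X| -> bool} * {ffun 'I_#|vert X| -> vert X}) :
    {ffun vert X -> bool} :=
  [ffun x => [exists i, (we.2 i == x) && we.1 i]].

Lemma labellingE (X : fin_tournament) (w : {ffun 'I_#|vert X| -> bool})
    (e : {ffun 'I_#|vert X| -> vert X}) i :
  embeds w e -> labelling (w, e) (e i) = w i.
Proof.
move=> eP; rewrite ffunE; apply/existsP/idP => /= [[j]|wi].
  by case/andP => /eqP /(embeds_inj eP) ->.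
by exists i; rewrite eqxx.
Qed.

Lemma labelling_order (X : fin_tournament) (w : {ffun 'I_#|vert X| -> bool})
    (e : {ffun 'I_#|vert X| -> vert X}) (g : vert X -> 'I_#|vert X|) x y :
  embeds w e -> cancel g e ->
  (g x < g y) = arc x y (+) (labelling (w, e) x (+) labelling (w, e) y).
Proof.
move=> eP gK; rewrite -{2 3}(gK x) -{2 3}(gK y) !labellingE // (embedsP _ _ eP).
by rewrite addbK.
Qed.

(** Arcs and labels together determine the order, hence the whole expansion; it suffices to count
    labellings. *)
Lemma labelling_inj (X : fin_tournament) :
  {in presentations X &, injective (@labelling X)}.
Proof.
move=> [w e] [w' e']; rewrite !inE /= => eP e'P ll.
have [g eK gK] := embeds_bij eP.
have ee' : e = e'.
  apply: (@increasing_uniq _ (val \o g));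
    last by rewrite (embeds_onto eP) (embeds_onto e'P).
    by apply/increasingP => i j; rewrite /= !eK.
  apply/increasingP => i j; rewrite /= (labelling_order _ _ eP gK) ll.
  rewrite !labellingE // (embedsP _ _ e'P).
  by rewrite addbK.
move: e'P ll; rewrite -ee' => e'P ll; congr (_, _); apply/ffunP => i.
by rewrite -(labellingE i eP) ll labellingE.
Qed.

Lemma labelling_image (X : fin_tournament) (w0 : {ffun 'I_#|vert X| -> bool})
    (e0 : {ffun 'I_#|vert X| -> vert X}) (g : vert X -> 'I_#|vert X|) :
  0 < #|vert X| -> embeds w0 e0 -> cancel g e0 -> cancel e0 g ->
  @labelling X @: presentations X =
  (fun mb : 'I_#|vert X| * bool =>
     [ffun x => (g x < mb.1) (+) mb.2 (+) w0 (g x)]) @: setT.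
Proof.
move=> n_gt0 e0P gK eK; apply/setP => c; apply/imsetP/imsetP.
  case=> -[w e]; rewrite inE /= => eP cE.
  have [f fK Kf] := embeds_bij eP.
  (* The difference from the labels of the reference expansion [e0] is a threshold pattern. *)
  pose d i := c (e0 i) (+) w0 i.
  have [|m [b mbE]] := @switch_threshold _ d (val \o f \o e0) n_gt0.
    move=> i j; rewrite /d /= (labelling_order _ _ eP Kf) -cE (embedsP _ _ e0P).
    by rewrite -addbA addbACA [w0 i (+) _]addbC [w0 j (+) _]addbC.
  exists (m, b) => //; apply/ffunP => x; rewrite !ffunE /= -mbE /d gK.
  by rewrite addbK.
case=> -[m b] _ cE; pose n := #|vert X|.
(* Rotate the circle: the first [m] points are moved to the end. *)
pose r x := if g x < m then g x + n else g x.
have gn x : g x < n by [].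
have g_inj := can_inj gK.
have rc : @expands X r c.
  split=> [x y rxy|x y].
    apply/g_inj/ord_inj; move: rxy (gn x) (gn y); rewrite /r.
    by case: (ltnP (g x) m); case: (ltnP (g y) m); lia.
  rewrite cE !ffunE /= /r -{1}(gK x) -{1}(gK y) (embedsP _ _ e0P).
  move: (gn x) (gn y); case: (ltnP (g x) m); case: (ltnP (g y) m);
    by case: b {cE}; case: (w0 (g x)) (w0 (g y)) => [] []; rewrite /=; lia.
have [h _ hP] := expands_word rc (cardsT _).
exists ([ffun i => c (h i)], h); rewrite ?inE //.
have [f fK Kf] := embeds_bij hP.
by apply/ffunP => x; rewrite -(Kf x) labellingE // ffunE.
Qed.

Lemma card_words_aut (X : fin_tournament) : inC X -> 0 < #|vert X| ->
  #|words X| * #|autT X| = 2 * #|vert X|.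
Proof.
move=> /inC_words[w0]; rewrite inE => /existsP[e0 e0P] n_gt0.
have [g eK gK] := embeds_bij e0P.
rewrite -card_presentations -(card_in_imset (@labelling_inj X)).
rewrite (labelling_image n_gt0 e0P gK eK) card_imset.
  by rewrite cardsT card_prod card_ord card_bool mulnC.
move=> [m b] [m' b'] /ffunP mbE.
have {}mbE (i : 'I_#|vert X|) : (i < m) (+) b = (i < m') (+) b'.
  by have := mbE (e0 i); rewrite !ffunE /= eK; apply: addIb.
(* The last position is never below [m] or [m'], so the patterns show [b] and [b'] there. *)
have bb' : b = b'.
  have last_lt : #|vert X|.-1 < #|vert X| by rewrite prednK.
  have last_max (k : 'I_#|vert X|) : (#|vert X|.-1 < k) = false.
    by have := ltn_ord k; lia.
  by have := mbE (Ordinal last_lt); rewrite !last_max.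
move: mbE; rewrite {}bb' => mbE; congr (_, _); apply: ord_inj.
have := mbE m; have := mbE m'; move=> /addIb + /addIb.
by lia.
Qed.

(** * Upper bound *)

Lemma ramsey_bound_words (X : fin_tournament) : ramsey_bound X #|words X|.
Proof.
move=> Y /inC_words[u]; rewrite inE => /existsP[eY eYP] k; pose m := #|vert Y|.
have [N NP] := @ramsey #|vert X| {ffun {ffun 'I_#|vert X| -> bool} -> 'I_k} (fun=> m).
(* Any word of length [N] can be read in [01...01] using one letter in each of
   the [N] blocks. *)
pose r (z : 'I_N * bool) := z.1.*2 + z.2.
have r_inj : injective r.
  move=> [i a] [j b]; rewrite /r /= => rij.
  have ij : i = j by apply: ord_inj; case: a b rij => [] [] /=; lia.
  by rewrite ij in rij *; congr (_, _); case: a b rij => [] [] //=; lia.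
exists (switch snd r_inj); split.
  by apply/inC_expands; exists r, snd; exact: switch_expands.
move=> chi.
(* The colour of a set of blocks is a whole function: it sends each word to the [chi]-colour of the
   vertices that spell it in these blocks. *)
pose col (s : seq 'I_N) : {ffun {ffun 'I_#|vert X| -> bool} -> 'I_k} :=
  [ffun w : {ffun 'I_#|vert X| -> bool} =>
     chi [set z : 'I_N * bool | z \in zip s (codom w)]].
have [|c0 [B [BA /eqP sB colB]]] := NP _ (enum 'I_N) col;
  first by rewrite size_enum_ord.
pose t := Tuple sB.
have B_sorted : sorted ltn (map val B).
  apply: subseq_sorted (map_subseq val BA) _; first exact: ltn_trans.
  by rewrite val_enum_ord iota_ltn_sorted.
have t_lt (i j : 'I_m) : i < j -> tnth t i < tnth t j.
  move=> ij; pose x0 := tnth t i; rewrite [tnth t i](tnth_nth x0) (tnth_nth x0) /=.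
  move: B_sorted; rewrite sorted_map => B_sorted.
  apply: (sorted_ltn_nth (leT := relpre val ltn)) => //.
  - by move=> ? ? ?; exact: ltn_trans.
  - by rewrite inE (eqP sB).
  - by rewrite inE (eqP sB).
(* The copy of [Y] takes the letter [u i] from the [i]-th block of the homogeneous set. *)
pose y := [ffun i : 'I_m => (tnth t i, u i)].
have yP : @embeds _ (switch snd r_inj) u y.
  apply/embedsP => i j; rewrite !ffunE /= /r /=; congr (_ (+) _).
  case: (ltngtP i j) => [/t_lt|/t_lt|/ord_inj ->]; last by rewrite ltnn.
  - by case: (u i) (u j) => [] [] /=; lia.
  - by case: (u i) (u j) => [] [] /=; lia.
exists (y @: setT); split; first exact: copy_of_word eYP yP.
(* Every colour that occurs is the value of [c0] at the word of the copy, so there are at most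
   [#|words X|] of them. *)
apply: leq_trans (leq_imset_card c0 _); apply: subset_leq_card.
apply/subsetP => _ /imsetP[S + ->]; rewrite inE => /andP[XS /subsetP SY].
have y_inj := embeds_inj yP.
have S_im : S = y @: (y @^-1: S).
  apply/setP => z; apply/idP/imsetP => [zS|[i + ->]]; last by rewrite inE.
  by have /imsetP[i _ zi] := SY z zS; exists i; rewrite // inE -zi.
have cS : #|y @^-1: S| = #|vert X|.
  by rewrite -(card_copy XS) [in RHS]S_im card_imset.
have [h /increasingP hP Sh] := enum_increasing (@ord_inj m) cS.
pose w := [ffun i => u (h i)]; pose yh := [ffun i => y (h i)].
have yhP : @embeds _ (switch snd r_inj) w yh.
  by apply/embedsP => i j; rewrite !ffunE -hP -(embedsP _ _ yP) !ffunE.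
have Syh : S = yh @: setT.
  rewrite S_im Sh -imset_comp; apply: eq_imset => i.
  by rewrite [RHS]ffunE.
apply/imsetP; exists w; first by apply: copy_words yhP _; rewrite -Syh.
have h_sorted : sorted (relpre val ltn) [seq h i | i <- enum 'I_#|vert X|].
  rewrite sorted_map; apply: (@sub_sorted _ (relpre val ltn)) => [i j|].
    by rewrite /= hP.
  by rewrite -sorted_map val_enum_ord iota_ltn_sorted.
have h_sub : subseq [seq h i | i <- enum 'I_#|vert X|] (enum 'I_m).
  rewrite (@irr_sorted_eq _ (relpre val ltn) _ _ [seq h i | i <- enum 'I_#|vert X|]
    [seq j <- enum 'I_m | j \in [seq h i | i <- enum 'I_#|vert X|]]) //.
  - exact: filter_subseq.
  - by move=> ? ? ?; exact: ltn_trans.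
  - by move=> ?; exact: ltnn.
  - apply: sorted_filter; first by move=> ? ? ?; exact: ltn_trans.
    by rewrite -sorted_map val_enum_ord iota_ltn_sorted.
  - by move=> j; rewrite mem_filter mem_enum andbT.
pose s := [seq tnth t (h i) | i <- enum 'I_#|vert X|].
have sB' : subseq s B.
  have BE : B = [seq tnth t i | i <- enum 'I_m] by rewrite map_tnth_enum.
  rewrite [X in subseq _ X]BE /s (map_comp (tnth t) h).
  exact: map_subseq.
have <- : col s = c0 by apply: colB; rewrite // size_map size_enum_ord.
rewrite /col [RHS]ffunE; congr (chi _).
rewrite Syh /codom /image_mem /s; apply/setP => z; rewrite inE zip_map.
apply/imsetP/mapP => [[i _ ->]|[i _ ->]]; exists i; rewrite ?mem_enum //.
  by rewrite !ffunE.
by rewrite !ffunE.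
Qed.

(** * Lower bound *)

Lemma ramsey_bound_ge_words (X : fin_tournament) l :
  0 < #|vert X| -> ramsey_bound X l -> #|words X| <= l.
Proof.
(* The alternating word has two halves of [n] blocks each, so that one half avoids the threshold
   that separates two expansions of [Y]. *)
move=> n_gt0; pose n := #|vert X|; pose u (i : 'I_(n.*2 + n.*2)) := odd i.
pose Y := switch u (@ord_inj _).
have YC : inC Y by apply/inC_expands; exists (@nat_of_ord _), u; exact: switch_expands.
move=> /(_ Y YC #|{ffun 'I_n -> bool}|)[Z [/inC_expands[r [c [r_inj rc]]] ZY]].
(* The word of [S] in a fixed expansion of [Z]. The default value concerns only sets that do not
   have [n] elements, never copies of [X]. *)
pose word_of (S : {set vert Z}) : {ffun 'I_n -> bool} :=
  if [pick h : {ffun 'I_n -> vert Z} | increasing r h && (S == h @: setT)]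
  is Some h then [ffun i => c (h i)] else [ffun=> false].
have word_ofE (h : {ffun 'I_n -> vert Z}) :
    increasing r h -> word_of (h @: setT) = [ffun i => c (h i)].
  move=> hP; rewrite /word_of; case: pickP => [h' /andP[h'P /eqP hh']|/(_ h)].
    by rewrite (increasing_uniq hP h'P hh').
  by rewrite hP eqxx.
have [Yt [/existsP[e /and3P[_ /forallP eP /eqP YtE]]]] :=
  ZY (fun S => enum_rank (word_of S)).
apply: leq_trans; rewrite -(card_imset (words X) (@enum_rank_inj _)).
apply: subset_leq_card; apply/subsetP => _ /imsetP[w wX ->].
have {}eP (i j : 'I_(n.*2 + n.*2)) : arc (e i) (e j) = (i < j) (+) (odd i (+) odd j).
  by rewrite -(eqP (forallP (eP _) _)).
pose d i := c (e i) (+) odd i.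
have reE (i j : 'I_(n.*2 + n.*2)) : (r (e i) < r (e j)) = (i < j) (+) (d i (+) d j).
  by rewrite /d addbACA [X in _ (+) X]addbC addbA -eP rc addbK.
have [|m [b mbE]] := @switch_threshold _ d (r \o e) _ reE.
  by rewrite -addnn -/n in n_gt0 *; lia.
(* On one of the two halves of [Y], [d] is constant: there any expansion of [Y]
   reads [01...01] or [10...10], so it contains every word of length [n]. *)
have [o [b' [o_even o_le oE]]] : exists o b', [/\ ~~ odd o, o <= n.*2 &
    forall i : 'I_(n.*2 + n.*2), o <= i < o + n.*2 -> d i = b'].
  have [nm|mn] := leqP n.*2 m.
    exists 0, (~~ b); split=> // i /andP[_ i_lt]; rewrite mbE.
    by rewrite (leq_trans i_lt).
  exists n.*2, b; rewrite odd_double; split=> // i /andP[i_ge _].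
  by rewrite mbE ltnNge (leq_trans (ltnW mn)).
(* From the [j]-th block of the chosen half take the letter whose label in [Z] is [w j]: as [o] is
   even and [d] equals [b'] there, its parity must be [w j (+) b']. *)
have p_lt (j : 'I_n) : o + j.*2 + (w j (+) b') < n.*2 + n.*2.
  by have := ltn_ord j; case: (_ (+) _); lia.
pose p j : 'I_(n.*2 + n.*2) := Ordinal (p_lt j).
have dp j : d (p j) = b'.
  by apply: oE; rewrite /=; have := ltn_ord j; case: (_ (+) _); lia.
pose h := [ffun j => e (p j)].
have cE j : c (h j) = w j.
  have := dp j; rewrite /d ffunE /= !oddD odd_double (negbTE o_even) oddb /=.
  by case: (c _) (w j) (b') => [] [] [].
have hP : increasing r h.
  apply/increasingP => i j.
  rewrite !ffunE reE !dp addbb addbF /=.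
  case: (ltngtP i j) => [ij|ij|/ord_inj ->]; last by rewrite ltnn.
    by case: (w i (+) b') (w j (+) b') => [] []; lia.
  by case: (w i (+) b') (w j (+) b') => [] []; lia.
have hw : embeds w h.
  by apply/embedsP => i j; rewrite rc !cE (increasingP _ _ hP).
apply/imsetP; exists (h @: setT).
  rewrite inE; have := wX; rewrite inE => /existsP[e0 e0P].
  rewrite (copy_of_word e0P hw) YtE; apply/subsetP => _ /imsetP[j _ ->].
  by rewrite ffunE imset_f.
by congr enum_rank; rewrite word_ofE //; apply/ffunP => j; rewrite ffunE cE.
Qed.

(* t_C(X) is finite and equals 2|X| / |Aut(X)|, i.e. t * |Aut X| = 2 |X|. *)
Theorem theorem1 (X : fin_tournament) (hX : inC X) (hne : 0 < #|vert X|) :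
  exists t : nat, ramsey_degree_is X t /\ t * #|autT X| = 2 * #|vert X|.
Proof.
exists #|words X|; split; last exact: card_words_aut.
by split=> [|l]; [exact: ramsey_bound_words | exact: ramsey_bound_ge_words].
Qed.
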